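(* For each $\beta \in [-\infty,\infty]$, let $$L(\beta) := \left\{ x \in (0,1] : \lim_{n\to\infty} \frac{\log d_n(x)-n}{\sqrt{2n\log\log n}} = \beta \right\}.$$ Then, for each $\beta \in [-\infty,\infty]$, $\dim_H L(\beta) = 1$.
   Context: Pierce expansion digits: for $x \in (0,1]$ put $d_1(x) := \lfloor 1/x \rfloor$ and $T(x) := 1 - d_1(x)x$, and for $k \in \mathbb{N}$ put $d_k(x) := d_1(T^{k-1}(x))$ provided $T^{k-1}(x) \neq 0$. All digits $d_k(x)$, $k \in \mathbb{N}$, are defined exactly when $x$ is irrational, and then they form a strictly increasing sequence of positive integers. Convention: a limiting condition on $(d_n(x))_n$, or a condition for all (large) $n$, is only considered for irrational $x$, so rational $x$ do not belong to sets defined by such conditions. $\mathbb{N}=\{1,2,\dots\}$, $\log$ is the natural logarithm, and $\dim_H$ is the Hausdorff dimension. *)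

(* Defs.v *)
From HB Require Import structures.
From mathcomp Require Import all_boot all_order all_algebra.
From mathcomp Require Import all_classical all_reals all_analysis.

Set Implicit Arguments.
Unset Strict Implicit.
Unset Printing Implicit Defensive.

Import Order.TTheory GRing.Theory Num.Theory.
Import numFieldNormedType.Exports.

Local Open Scope classical_set_scope.
Local Open Scope ring_scope.

Section HausdorffDimension.
Context {R : realType}.
Local Open Scope ereal_scope.

(* The diameter of the empty set is -oo here; [hausdorff_weight] treats the
   empty set separately. *)
Definition diameter (A : set R) : \bar R :=
  ereal_sup [set `|x - y|%:E | x in A & y in A].

(* diam(A)^s, with the usual conventions at s = 0: 0 for the empty set and
   0^0 = 1 for a singleton. *)
Definition hausdorff_weight (s : R) (A : set R) : \bar R :=
  if A == set0 then 0 else poweR (diameter A) s.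

Definition delta_cover (delta : R) (A : set R) (U : (set R)^nat) : Prop :=
  A `<=` \bigcup_i U i /\ forall i, diameter (U i) <= delta%:E.

Definition hausdorff_premeasure (s delta : R) (A : set R) : \bar R :=
  ereal_inf [set \sum_(0 <= i <oo) hausdorff_weight s (U i)
            | U in delta_cover delta A].

(* The supremum over delta > 0 is the limit as delta -> 0+, since the
   premeasure is nonincreasing in delta. *)
Definition hausdorff_measure (s : R) (A : set R) : \bar R :=
  ereal_sup [set hausdorff_premeasure s delta A
            | delta in [set delta : R | (0 < delta)%R]].

Definition hausdorff_dim (A : set R) : \bar R :=
  ereal_inf [set s%:E | s in [set s : R | (0 <= s)%R /\
                                          hausdorff_measure s A = 0]].

End HausdorffDimension.

Section PierceExpansion.
Context {R : realType}.

Definition pierce_digit1 (x : R) : int := Num.floor (1 / x).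

Definition pierce_map (x : R) : R := 1 - (pierce_digit1 x)%:~R * x.

(* The k-th digit, with k counted from 1; it is meaningful only when
   [iter k.-1 pierce_map x != 0], which holds for every k when x is an
   irrational element of `]0, 1]. The value at k = 0 is a dummy. *)
Definition pierce_digit (k : nat) (x : R) : int :=
  pierce_digit1 (iter k.-1 pierce_map x).

(* The division and the square root take dummy values at n = 0, 1, 2, where
   log (log n) is undefined or negative. *)
Definition pierce_lil_ratio (x : R) (n : nat) : R :=
  (ln (pierce_digit n x)%:~R - n%:R) / Num.sqrt (2 * n%:R * ln (ln n%:R)).

(* Rational numbers have only finitely many digits, and are excluded. *)
Definition pierce_lil_set (beta : \bar R) : set R :=
  [set x | [/\ x \in `]0, 1], irrational x &
             (pierce_lil_ratio x n)%:E @[n --> \oo] --> beta]].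

End PierceExpansion.

(* Main.v *)
Require Import Defs.
From mathcomp Require Import all_boot all_order all_algebra.
From mathcomp Require Import all_classical all_reals all_analysis.
From mathcomp Require Import zify ring lra.

Set Implicit Arguments.
Unset Strict Implicit.
Unset Printing Implicit Defensive.

Import Order.TTheory GRing.Theory Num.Theory.
Import numFieldNormedType.Exports.

Local Open Scope classical_set_scope.
Local Open Scope ring_scope.

(** The upper bound is the dimension of the line.  For the lower bound, a large
    Cantor set is exhibited inside each of the sets.

    Given strictly increasing exponents a_0 < a_1 < ... with a_i = O(i), let E be
    the set of all x whose digits satisfy 2^(a_i) <= d_(i+1)(x) < 2^(a_i + 1) for
    all i.  The dyadic ranges are disjoint and increasing, so each digit can be
    chosen freely in its range: d_(i+1) - 2^(a_i) is an arbitrary block of a_i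
    bits.  Concatenating the blocks parametrizes E by the binary expansions of
    the points t of [0, 1); let G be this parametrization.  If t and t' have the
    same first n blocks, then |t - t'| <= 2^-(A_n), with A_n = a_0 + ... + a_(n-1)
    ([pierce_code_close]).  If the blocks of index n differ, the recursion
    x = (1 - T(x)) / d_1(x) gives a lower bound 2^-(A_n + n + 3 (a_n + 1)) for
    |G t - G t'| ([pierce_code_separation]).  As A_n grows quadratically and the
    remaining terms of the exponent linearly, |t - t'| <= C |G t - G t'|^s for
    every s < 1 ([pierce_code_holder]).  The inverse of G is thus Hoelder of every
    exponent s < 1, and maps E onto a set of length 1: a cover of E with a small
    sum of s-th powers of diameters would be turned into a cover of [0, 1) of
    total length less than 1 ([hausdorff_measure_neq0]).  This plays the part of
    the mass distribution principle without the construction of a measure.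

    It remains to choose the exponents.  On E, log d_n lies between
    a_(n-1) log 2 and (a_(n-1) + 1) log 2, and the error log 2 is absorbed by the
    normalization h(n) = sqrt (2 n log log n).  The ratio therefore has the limit
    of (a_(n-1) log 2 - n) / h(n) ([pierce_lil_set_code]).  For beta = -oo,
    a_(n-1) = n works since log 2 < 1; for beta = +oo, a_(n-1) = 3 n works since
    3 log 2 > 1.  For a real beta, a_(n-1) is the integer part of
    (n + beta h(n)) / log 2 for n large; these integers increase strictly because
    h(n+1) - h(n) tends to 0 and 1 / log 2 > 1. *)

(** * Numbers with prescribed Pierce digits *)

Section PierceValue.
Context {R : realType}.
Implicit Types (d : nat -> nat) (m n i : nat).

Definition shift_digits d i := d i.+1.

(** The bound 1 < d 0 makes each digit at least 2, so that the truncated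
    expansions converge geometrically. *)
Definition digit_sequence d := (1 < d 0%N)%N /\ forall i, (d i < d i.+1)%N.

Lemma digit_sequence_shift d : digit_sequence d -> digit_sequence (shift_digits d).
Proof. by move=> [d0 dS]; split; [exact: ltn_trans d0 (dS 0%N)|move=> i; exact: dS]. Qed.

(** The expansion truncated after m digits, in nested form:
    (1 - (1 - (1 - ...) / d_2) / d_1) / d_0. *)
Fixpoint pierce_sum m d : R :=
  if m is m'.+1 then (1 - pierce_sum m' (shift_digits d)) / (d 0%N)%:R else 0.

Definition pierce_value d : R := limn (fun m => pierce_sum m d).

Lemma pierce_sum_bounds m d :
  digit_sequence d -> 0 <= pierce_sum m d <= (d 0%N)%:R^-1.
Proof.
elim: m d => [|m IH] d hd; first by rewrite /= lexx invr_ge0 ler0n.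
have hd' := digit_sequence_shift hd; have /andP[s0 s1] := IH _ hd'.
have s1' : pierce_sum m (shift_digits d) <= 1.
  apply: le_trans s1 _; rewrite invf_le1 ?ltr0n ?ler1n; have [? _] := hd'; lia.
rewrite /= divr_ge0 ?ler0n ?subr_ge0//= ler_piMl ?invr_ge0 ?ler0n//.
by rewrite lerBlDr lerDl.
Qed.

(** Each level of the nested form divides the difference by a digit, which is at
    least 2. *)
Lemma pierce_sum_step m d : digit_sequence d ->
  `|pierce_sum m.+1 d - pierce_sum m d| <= 2^-1 ^+ m.
Proof.
elim: m d => [|m IH] d hd.
  have /andP[h0 h1] := pierce_sum_bounds 1 hd.
  rewrite expr0 subr0 ger0_norm//; apply: le_trans h1 _.
  by rewrite invf_le1 ?ltr0n ?ler1n; case: hd => ? _; lia.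
have -> : pierce_sum m.+2 d - pierce_sum m.+1 d =
    - (pierce_sum m.+1 (shift_digits d) - pierce_sum m (shift_digits d)) / (d 0%N)%:R.
  by rewrite /=; ring.
rewrite normrM normrN exprSr ler_pM//; first exact/IH/digit_sequence_shift.
rewrite ger0_norm ?invr_ge0 ?ler0n// lef_pV2 ?posrE ?ltr0n ?ler_nat//.
  by case: hd.
by case: hd => ? _; lia.
Qed.

Lemma cvg_pierce_sum d : digit_sequence d ->
  pierce_sum m d @[m --> \oo] --> pierce_value d.
Proof.
move=> hd; rewrite /pierce_value.
suff h : cvgn (series (telescope (pierce_sum ^~ d))).
  suff e : series (telescope (pierce_sum ^~ d)) = pierce_sum ^~ d by rewrite e in h.
  by rewrite telescopeK; apply/funext => m /=; rewrite subr0.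
apply: normed_cvg; apply: (@series_le_cvg _ _ (geometric 1 2^-1)).
- by move=> n; exact: normr_ge0.
- by move=> n; rewrite /= mul1r exprn_ge0.
- by move=> n; rewrite /geometric/= mul1r; exact: pierce_sum_step.
- by apply: is_cvg_geometric_series; rewrite ger0_norm ?invr_ge0// invf_lt1// ltr1n.
Qed.

Lemma pierce_value_shift d : digit_sequence d ->
  pierce_value (shift_digits d) = 1 - (d 0%N)%:R * pierce_value d.
Proof.
move=> hd; apply: (cvg_unique _ (cvg_pierce_sum (digit_sequence_shift hd))) => //.
have d0 : (d 0%N)%:R != 0 :> R by rewrite pnatr_eq0; case: hd => ? _; lia.
have -> : pierce_sum ^~ (shift_digits d) =
    (fun m => 1 - (d 0%N)%:R * pierce_sum m.+1 d).
  by apply/funext => m /=; rewrite mulrC divfK//; ring.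
apply: cvgB; first exact: cvg_cst.
apply: cvgMl_tmp; rewrite (cvg_shiftS (pierce_sum ^~ d)).
exact: cvg_pierce_sum.
Qed.

Lemma pierce_value_weak_bounds d : digit_sequence d ->
  0 <= pierce_value d <= (d 0%N)%:R^-1.
Proof.
move=> hd; apply/andP; split.
  apply: (cvgr_to_ge (cvg_pierce_sum hd)); near=> m.
  by have /andP[] := pierce_sum_bounds m hd.
apply: (cvgr_to_le (cvg_pierce_sum hd)); near=> m.
by have /andP[] := pierce_sum_bounds m hd.
Unshelve. all: by end_near. Qed.

Lemma pierce_valueE d : digit_sequence d ->
  pierce_value d = (1 - pierce_value (shift_digits d)) / (d 0%N)%:R.
Proof.
move=> hd; rewrite pierce_value_shift//.
have d0 : (d 0%N)%:R != 0 :> R by rewrite pnatr_eq0; case: hd => ? _; lia.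
by field.
Qed.

(** Strictness comes from the next level: the value of the shifted sequence is at
    most 1 / d_1 < 1.  The two bounds that follow are obtained in the same way,
    each from the previous one applied to the shifted sequence. *)
Lemma pierce_value_gt0 d : digit_sequence d -> 0 < pierce_value d.
Proof.
move=> hd; have hd' := digit_sequence_shift hd.
rewrite pierce_valueE// divr_gt0 ?ltr0n//; last by case: hd => ? _; lia.
have /andP[_ h] := pierce_value_weak_bounds hd'.
by rewrite subr_gt0 (le_lt_trans h)// invf_lt1 ?ltr0n ?ltr1n//; case: hd' => ? _; lia.
Qed.

Lemma pierce_value_lt d : digit_sequence d -> pierce_value d < (d 0%N)%:R^-1.
Proof.
move=> hd; have hd' := digit_sequence_shift hd.
rewrite pierce_valueE// gtr_pMl ?invr_gt0 ?ltr0n//; last by case: hd => ? _; lia.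
by rewrite ltrBlDr ltrDl pierce_value_gt0.
Qed.

Lemma pierce_value_gt d : digit_sequence d -> (d 0%N).+1%:R^-1 < pierce_value d.
Proof.
move=> hd; have hd' := digit_sequence_shift hd.
have d0 : 0 < (d 0%N)%:R :> R by rewrite ltr0n; case: hd => ? _; lia.
have h := pierce_value_lt hd'.
have h2 : (shift_digits d 0%N)%:R^-1 <= (d 0%N).+1%:R^-1 :> R.
  rewrite lef_pV2 ?posrE ?ltr0n//; last by case: hd' => ? _; lia.
  by rewrite ler_nat; case: hd => _; apply.
rewrite pierce_valueE// ltr_pdivlMr//.
have -> : (d 0%N).+1%:R^-1 * (d 0%N)%:R = 1 - (d 0%N).+1%:R^-1 :> R.
  by rewrite -natr1; field; rewrite natr1 pnatr_eq0.
by rewrite ltrD2l ltrN2 (lt_le_trans h).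
Qed.

Lemma pierce_digit1_value d : digit_sequence d ->
  pierce_digit1 (pierce_value d) = d 0%N :> int.
Proof.
move=> hd; apply: floor_def; have v0 := pierce_value_gt0 hd.
have d0 : 0 < (d 0%N)%:R :> R by rewrite ltr0n; case: hd => ? _; lia.
have h1 := pierce_value_lt hd; have h2 := pierce_value_gt hd.
rewrite div1r -PoszD addn1 -!pmulrn; apply/andP; split.
  by rewrite -[leLHS]invrK lef_pV2 ?posrE ?invr_gt0// ltW.
by rewrite -[ltRHS]invrK ltf_pV2 ?posrE ?invr_gt0 ?ltr0n.
Qed.

Lemma pierce_map_value d : digit_sequence d ->
  pierce_map (pierce_value d) = pierce_value (shift_digits d).
Proof.
by move=> hd; rewrite /pierce_map pierce_digit1_value// pierce_value_shift// -pmulrn.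
Qed.

Lemma pierce_digit_value d n : digit_sequence d ->
  pierce_digit n.+1 (pierce_value d) = d n :> int.
Proof.
rewrite /pierce_digit /=; elim: n d => [|n IH] d hd; first exact: pierce_digit1_value.
by rewrite iterSr pierce_map_value// IH//; exact: digit_sequence_shift.
Qed.

Lemma pierce_value_itv d : digit_sequence d -> pierce_value d \in `]0, 1].
Proof.
move=> hd; rewrite in_itv/= pierce_value_gt0//= ltW// (lt_trans (pierce_value_lt hd))//.
by rewrite invf_lt1 ?ltr0n ?ltr1n//; case: hd => ? _; lia.
Qed.

(** Infinite descent: if x q is a natural number, then so is T(x) q, and it is
    smaller because T(x) < 1 / (d_0 + 1) < x. *)
Lemma pierce_value_no_fraction (p q : nat) d : (0 < q)%N -> digit_sequence d ->
  pierce_value d * q%:R <> p%:R.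
Proof.
move=> q0; elim/ltn_ind: p d => p IH d hd pq.
have hd' := digit_sequence_shift hd; have v0 := pierce_value_gt0 hd'.
have qR : 0 < q%:R :> R by rewrite ltr0n.
have e : pierce_value (shift_digits d) * q%:R = q%:R - (d 0%N * p)%:R.
  by rewrite pierce_value_shift// natrM -pq; ring.
have lt : (d 0%N * p < q)%N by rewrite -(ltr_nat R) -subr_gt0 -e mulr_gt0.
apply: (IH (q - d 0%N * p)%N _ (shift_digits d) hd'); last first.
  by rewrite e natrB// ltnW.
rewrite -(ltr_nat R) (natrB _ (ltnW lt)) -e -pq (ltr_pM2r qR).
apply: lt_trans (pierce_value_lt hd') _; apply: le_lt_trans (pierce_value_gt hd).
rewrite lef_pV2 ?posrE ?ltr0n//; last by case: hd' => ? _; lia.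
by rewrite ler_nat; case: hd => _; apply.
Qed.

Lemma irrational_pierce_value d : digit_sequence d -> irrational (pierce_value d).
Proof.
move=> hd [r _ hr]; have v0 := pierce_value_gt0 hd.
have r0 : 0 < r by rewrite -(ltr0q R) hr.
apply: (@pierce_value_no_fraction `|numq r|%N `|denq r|%N d) => //.
  by rewrite absz_gt0 denq_neq0.
rewrite -hr /ratr !pmulrn !gez0_abs ?denq_ge0 ?numq_ge0 ?ltW//.
by rewrite divfK// intr_eq0 denq_neq0.
Qed.

End PierceValue.

(** * Separation of numbers whose digits differ *)

Section Separation.
Context {R : realType}.
Implicit Types (d : nat -> nat) (n i : nat).

(** With j = d_0 < k = d'_0, the two numbers lie in the
    intervals (1 / (j + 1), 1 / j) and (1 / (k + 1), 1 / k).  The first one stays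
    away from the left end of its interval because its next digit exceeds k:
    it is at least (1 - 1 / (j + 2)) / j, so the gap is at least
    1 / (j (j + 1) (j + 2)). *)
Lemma pierce_value_gap d d' : digit_sequence d -> digit_sequence d' ->
  (d 0 < d' 0)%N -> (d' 0 < d 1)%N ->
  (d' 0%N).+1%:R ^- 3 <= pierce_value d - pierce_value d' :> R.
Proof.
move=> hd hd' lt0 lt1.
have j1 : 1 <= (d 0%N)%:R :> R by rewrite ler1n; case: hd => ? _; lia.
have jk : (d 0%N)%:R + 1 <= (d' 0%N)%:R :> R by rewrite natr1 ler_nat.
have h1 : pierce_value (shift_digits d) <= ((d 0%N)%:R + 2)^-1 :> R.
  apply/ltW/(lt_le_trans (pierce_value_lt (digit_sequence_shift hd))).
  have d1 : (d 0%N)%:R + 2 <= (shift_digits d 0%N)%:R :> R.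
    by rewrite -natrD ler_nat addn2 /shift_digits (leq_ltn_trans lt0 lt1).
  by rewrite lef_pV2 ?posrE//; lra.
have h2 : pierce_value d' <= ((d 0%N)%:R + 1)^-1 :> R.
  apply/ltW/(lt_le_trans (pierce_value_lt hd')).
  by rewrite lef_pV2 ?posrE//; lra.
rewrite [pierce_value d]pierce_valueE// -natr1.
move: (d 0%N)%:R (d' 0%N)%:R (pierce_value _) (pierce_value _) j1 jk h1 h2.
move=> j k p q j1 jk h1 h2.
apply: (@le_trans _ _ ((1 - (j + 2)^-1) / j - (j + 1)^-1)); last first.
  by rewrite lerB// ler_wpM2r ?invr_ge0 ?lerB//; lra.
have -> : (1 - (j + 2)^-1) / j - (j + 1)^-1 = (j * (j + 1) * (j + 2))^-1.
  by field; apply/and3P; split; apply/eqP; lra.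
have a1 : 0 < j * (j + 1) by rewrite mulr_gt0; lra.
rewrite lef_pV2 ?posrE ?exprn_gt0 ?mulr_gt0//; try lra.
by rewrite !exprS expr0 mulr1 mulrA ler_pM ?mulr_ge0 ?ler_pM//; lra.
Qed.

(** The map T expands the distance of two numbers with the same first digit by
    exactly that digit, which is at most M_0.  After n such steps the first digits
    differ, and the previous lemma applies. *)
Lemma pierce_value_separation (M d d' : nat -> nat) n :
  digit_sequence d -> digit_sequence d' ->
  (forall i, d i < M i <= d i.+1)%N -> (forall i, d' i < M i <= d' i.+1)%N ->
  (forall i, (i < n)%N -> d i = d' i) -> d n <> d' n ->
  1 <= (\prod_(i < n) M i * M n ^ 3)%:R * `|pierce_value d - pierce_value d'| :> R.
Proof.
elim: n M d d' => [|n IH] M d d' hd hd' dM d'M eqd neqd.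
  rewrite big_ord0 mul1n.
  wlog lt0 : d d' hd hd' dM d'M {eqd} neqd / (d 0 < d' 0)%N.
    move=> W; case: (ltngtP (d 0%N) (d' 0%N)) => [| |//]; first exact: W.
    by rewrite distrC; apply: W => // /esym.
  have [/andP[d'0 _] /andP[_ d1]] := (d'M 0%N, dM 0%N).
  have h := pierce_value_gap hd hd' lt0 (leq_trans d'0 d1).
  have M0 : 0 < (M 0%N)%:R ^+ 3 :> R.
    by rewrite exprn_gt0// ltr0n (leq_ltn_trans _ d'0).
  rewrite natrX mulrC -ler_pdivrMr// div1r (le_trans _ (ler_norm _))//.
  apply: le_trans h; rewrite lef_pV2 ?posrE// ?exprn_gt0 ?ltr0n//.
  by rewrite lerXn2r ?nnegrE ?ler0n// ler_nat.
have h := IH (shift_digits M) _ _ (digit_sequence_shift hd)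
  (digit_sequence_shift hd') (fun i => dM i.+1) (fun i => d'M i.+1)
  (fun i => eqd i.+1) neqd.
apply: (le_trans h); have d0 := eqd 0%N isT.
rewrite (pierce_value_shift hd) (pierce_value_shift hd') -d0.
have -> (u v w : R) : 1 - u * v - (1 - u * w) = - u * (v - w) by ring.
rewrite normrM normrN normr_nat mulrA ler_wpM2r//.
rewrite -natrM ler_nat big_ord_recl /shift_digits /= mulnC !mulnA !leq_mul//.
by have /andP[/ltnW] := dM 0%N.
Qed.

End Separation.

(** * Coding the unit interval by digit sequences *)

Section BinaryCoding.
Context {R : realType} (a : nat -> nat).
Context (a0 : (0 < a 0)%N) (aS : forall i, (a i < a i.+1)%N).
Implicit Types (t : R) (n i : nat).

Definition bits n := (\sum_(i < n) a i)%N.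

(** The integer written by the first [bits n] binary digits of t. *)
Definition bit_prefix t n : nat := Num.truncn (2 ^+ bits n * t).

(** The truncated subtraction is exact for 0 <= t, by [bit_prefixS]; it yields the
    integer written by the i-th block of a_i binary digits of t. *)
Definition pierce_code t i : nat :=
  (2 ^ a i + (bit_prefix t i.+1 - 2 ^ a i * bit_prefix t i))%N.

Lemma bit_prefixS t i : 0 <= t ->
  (2 ^ a i * bit_prefix t i <= bit_prefix t i.+1 < 2 ^ a i * (bit_prefix t i).+1)%N.
Proof.
move=> t0; rewrite /bit_prefix /bits big_ord_recr /= -/(bits i) addnC exprD -mulrA.
have x0 : 0 <= 2 ^+ bits i * t by rewrite mulr_ge0// exprn_ge0.
have e0 : 0 < 2 ^+ a i :> R by rewrite exprn_gt0.
have /andP[h1 h2] := truncn_itv x0.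
rewrite truncn_ge_nat ?truncn_lt_nat ?mulr_ge0 ?(ltW e0)//.
by rewrite !natrM natrX ler_pM2l// ltr_pM2l// h1.
Qed.

Lemma pierce_code_itv t i : 0 <= t ->
  (2 ^ a i <= pierce_code t i < 2 ^ (a i).+1)%N.
Proof.
clear a0 aS => t0; have := bit_prefixS i t0; rewrite /pierce_code expnS mulnS; lia.
Qed.

Lemma pierce_code_itvS t i : 0 <= t ->
  (pierce_code t i < 2 ^ (a i).+1 <= pierce_code t i.+1)%N.
Proof.
move=> t0; have /andP[_ ->] := pierce_code_itv i t0.
have /andP[h _] := pierce_code_itv i.+1 t0.
by apply: leq_trans h; rewrite leq_exp2l.
Qed.

Lemma digit_sequence_code t : 0 <= t -> digit_sequence (pierce_code t).
Proof.
move=> t0; split; last first.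
  by move=> i; have /andP[] := pierce_code_itvS i t0; exact: leq_trans.
have /andP[h _] := pierce_code_itv 0 t0; apply: leq_trans h.
by rewrite -[leqLHS]/(2 ^ 1)%N leq_exp2l.
Qed.

Lemma bit_prefix_code t t' n : 0 <= t < 1 -> 0 <= t' < 1 ->
  (forall i, (i < n)%N -> pierce_code t i = pierce_code t' i) ->
  bit_prefix t n = bit_prefix t' n.
Proof.
clear a0 aS => /andP[t0 t1] /andP[t'0 t'1]; elim: n => [|n IH] eqc.
  rewrite /bit_prefix /bits big_ord0 expr0 !mul1r.
  by rewrite !(@truncn_def _ _ 0) ?t0 ?t'0.
have e1 := IH (fun i h => eqc i (ltnW h)); have e2 := eqc n (ltnSn n).
move: (bit_prefixS n t0) (bit_prefixS n t'0) e2; rewrite /pierce_code e1; lia.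
Qed.

Lemma pierce_code_close t t' n : 0 <= t < 1 -> 0 <= t' < 1 ->
  (forall i, (i < n)%N -> pierce_code t i = pierce_code t' i) ->
  `|t - t'| <= 2 ^- bits n.
Proof.
move=> ht ht' /(bit_prefix_code ht ht').
move: ht ht' => /andP[t0 _] /andP[t'0 _] e.
have e0 : 0 < 2 ^+ bits n :> R by rewrite exprn_gt0.
rewrite -(ler_pM2l e0) divff ?gt_eqF// -{1}(ger0_norm (ltW e0)) -normrM mulrBr.
have := truncn_itv (mulr_ge0 (ltW e0) t0); have := truncn_itv (mulr_ge0 (ltW e0) t'0).
rewrite -/(bit_prefix t n) -/(bit_prefix t' n) e -natr1 ler_norml.
by move=> /andP[h1 h2] /andP[h3 h4]; apply/andP; split; lra.
Qed.

(** Strictly increasing exponents have a quadratic sum; it dominates the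
    terms linear in n in the separation bound. *)
Lemma bits_ge n : (n * n <= 2 * bits n)%N.
Proof.
have ai i : (i < a i)%N by elim: i => // i IH; exact: leq_ltn_trans IH (aS i).
elim: n => // n IH; rewrite /bits big_ord_recr /= -/(bits n).
by have := ai n; lia.
Qed.

Lemma pierce_code_neq t t' : 0 <= t < 1 -> 0 <= t' < 1 -> t != t' ->
  exists2 n, (forall i, (i < n)%N -> pierce_code t i = pierce_code t' i) &
             pierce_code t n <> pierce_code t' n.
Proof.
move=> ht ht' tt'.
have [/ex_minnP[n /eqP neqn minn]|/forallNP h] :=
    pselect (exists n, pierce_code t n != pierce_code t' n).
  exists n => // i lti; apply/eqP; apply: contraTT lti => neqi.
  by rewrite -leqNgt minn.
exfalso; have dt : 0 < `|t - t'| by rewrite normr_gt0 subr_eq0.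
pose m := (Num.truncn (`|t - t'|^-1)).+1.
have di : 0 < `|t - t'|^-1 by rewrite invr_gt0.
have /andP[_ hm] := truncn_itv (ltW di); rewrite -/m in hm.
have : `|t - t'| <= 2 ^- bits m.
  by apply: pierce_code_close => // i _; have /negP := h i; rewrite negbK => /eqP.
apply/negP; rewrite -ltNge -[ltRHS]invrK ltf_pV2 ?posrE ?invr_gt0 ?exprn_gt0//.
apply: (lt_le_trans hm); rewrite -natrX ler_nat.
have := bits_ge m; have : (bits m < 2 ^ bits m)%N by rewrite ltn_expl.
rewrite /m; nia.
Qed.

Lemma pierce_code_separation t t' n : 0 <= t -> 0 <= t' ->
  (forall i, (i < n)%N -> pierce_code t i = pierce_code t' i) ->
  pierce_code t n <> pierce_code t' n ->
  2 ^- (bits n + n + 3 * (a n).+1) <=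
    `|pierce_value (pierce_code t) - pierce_value (pierce_code t')| :> R.
Proof.
move=> t0 t'0 eqc neqc.
have := @pierce_value_separation R (fun i => 2 ^ (a i).+1)%N _ _ n
  (digit_sequence_code t0) (digit_sequence_code t'0)
  (fun i => pierce_code_itvS i t0) (fun i => pierce_code_itvS i t'0) eqc neqc.
rewrite -expn_sum (eq_bigr (fun i : 'I_n => a i + 1)%N) => [|i _]; last by rewrite addn1.
rewrite big_split sum_nat_const card_ord muln1 /= -/(bits n) -expnM -expnD natrX.
rewrite mulrC -ler_pdivrMr ?exprn_gt0//.
by rewrite mul1r [((a n).+1 * 3)%N]mulnC.
Qed.

(** With n the first index where the codes differ, s < 1 and Q = 3 K + 3, the
    claim reduces to s (A_n + Q (n + 1)) <= A_n + c for a constant c, and A_n is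
    at least n^2 / 2. *)
Lemma pierce_code_holder (K : nat) (s : R) : (forall i, (a i <= K * i.+1)%N) ->
  0 <= s < 1 ->
  exists2 C : R, 0 < C & forall t t', 0 <= t < 1 -> 0 <= t' < 1 ->
    `|t - t'| <=
    C * `|pierce_value (pierce_code t) - pierce_value (pierce_code t')| `^ s.
Proof.
move=> aK /andP[s0 s1].
pose Q : R := 3 * K%:R + 3.
exists (2 `^ (Q + Q ^+ 2 / (2 * (1 - s)))); first by rewrite powR_gt0.
move=> t t' ht ht'; have [->|tt'] := eqVneq t t'.
  by rewrite subrr normr0 mulr_ge0 ?powR_ge0.
have [n eqc neqc] := pierce_code_neq ht ht' tt'.
apply: (le_trans (pierce_code_close ht ht' eqc)).
have /andP[t0 _] := ht; have /andP[t'0 _] := ht'.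
have sep := pierce_code_separation t0 t'0 eqc neqc.
set D := `|_ - _| in sep *; set N := (_ + _)%N in sep.
apply: (@le_trans _ _ (2 `^ (Q + Q ^+ 2 / (2 * (1 - s))) * (2 ^- N) `^ s)); last first.
  rewrite ler_wpM2l ?powR_ge0//; apply: ge0_ler_powR => //; rewrite nnegrE.
    by rewrite invr_ge0 exprn_ge0.
  exact: normr_ge0.
have pw m : 2 ^- m = 2 `^ (- m%:R) :> R by rewrite powRN powR_mulrn.
rewrite !pw -powRrM -powRD ?pnatr_eq0 ?implybT//.
rewrite ler_powR ?ler1n//.
have hb : n%:R * n%:R <= 2 * (bits n)%:R :> R by rewrite -!natrM ler_nat bits_ge.
have hN : N%:R <= (bits n)%:R + Q * (n%:R + 1) :> R.
  rewrite /Q natr1 -!natrM -natrD -natrM -natrD ler_nat /N; have := aK n; nia.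
have hs : 0 < 1 - s by lra.
have hq : Q ^+ 2 / (2 * (1 - s)) = (Q ^+ 2 / (1 - s)) / 2.
  by field; apply/eqP; lra.
set q := Q ^+ 2 / (1 - s) in hq; rewrite hq.
(* Completing the square absorbs the linear term [Q n] into the part of [bits n]
   that is left over since [s < 1]. *)
have hsq : 2 * Q * n%:R <= (1 - s) * (n%:R * n%:R) + q.
  have -> : (1 - s) * (n%:R * n%:R) + q =
      2 * Q * n%:R + ((1 - s) * n%:R - Q) ^+ 2 / (1 - s).
    by rewrite /q; field; apply/eqP; lra.
  by rewrite lerDl divr_ge0 ?sqr_ge0// ltW.
have Q0 : 0 <= Q by rewrite /Q; have := ler0n R K; lra.
have h1 := ler_wpM2l s0 hN.
have h2 := ler_wpM2l (ltW hs) hb.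
have n0 := ler0n R n.
have h3 : s * (Q * (n%:R + 1)) <= Q * (n%:R + 1).
  by rewrite ler_piMl ?(ltW s1)// mulr_ge0// addr_ge0.
rewrite mulrDr in h1.
lra.
Qed.

End BinaryCoding.

(** * Hausdorff dimension of subsets of the unit interval *)

Section HausdorffDimension.
Context {R : realType}.
Implicit Types (A U : set R) (s : R).

Lemma hausdorff_weight_ge0 s U : (0 <= hausdorff_weight s U)%E.
Proof. by rewrite /hausdorff_weight; case: ifP => // _; exact: poweR_ge0. Qed.

Lemma diameter_ge U x y : U x -> U y -> (`|x - y|%:E <= diameter U)%E.
Proof. by move=> Ux Uy; apply: ereal_sup_ubound; exists x => //; exists y. Qed.

Lemma hausdorff_weightE s U : (diameter U <= 1)%E -> U !=set0 ->
  exists r : R, [/\ 0 <= r, hausdorff_weight s U = (r `^ s)%:E &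
                    forall x y, U x -> U y -> `|x - y| <= r].
Proof.
move=> U1 U0; have [x0 Ux0] := U0.
have d0 : (0 <= diameter U)%E by have := diameter_ge Ux0 Ux0; rewrite subrr normr0.
have dfin : diameter U \is a fin_num.
  by rewrite ge0_fin_numE// (le_lt_trans U1)// ltry.
exists (fine (diameter U)); split; first exact: fine_ge0.
  rewrite /hausdorff_weight ifF; last by apply/eqP => e; rewrite e in Ux0.
  by rewrite -{1}(fineK dfin) poweR_EFin.
by move=> x y Ux Uy; rewrite -lee_fin fineK// diameter_ge.
Qed.

(** The preimage under G of a set of diameter r is contained in a closed interval
    of length 2 C r^s.  The preimages of the members of a cover of A cover [0, 1),
    whose Lebesgue measure is 1, so the sum of the weights is at least
    1 / (2 C). *)
Lemma hausdorff_measure_neq0 A (G : R -> R) s (C : R) :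
  0 <= s -> 0 < C -> (forall t : R, 0 <= t < 1 -> A (G t)) ->
  (forall t t' : R, 0 <= t < 1 -> 0 <= t' < 1 -> `|t - t'| <= C * `|G t - G t'| `^ s) ->
  hausdorff_measure s A != 0%E.
Proof.
move=> s0 C0 AG holder; rewrite gt_eqF//.
have C2 : 0 < 2 * C by rewrite mulr_gt0.
suff h : ((2 * C)^-1%:E <= hausdorff_premeasure s 1 A)%E.
  apply: (@lt_le_trans _ _ (2 * C)^-1%:E); first by rewrite lte_fin invr_gt0.
  by apply: (le_trans h); apply: ereal_sup_ubound; exists 1 => //=.
apply: le_ereal_inf_tmp => _ [U [AU diamU] <-].
have /choice[F hF] : forall i, exists V : set R,
    [/\ measurable V, forall t, 0 <= t < 1 -> U i (G t) -> V t &
        (lebesgue_measure V <= (2 * C)%:E * hausdorff_weight s (U i))%E].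
  move=> i.
  have [[t0 [ht0 Ut0]]|none] := pselect (exists t, 0 <= t < 1 /\ U i (G t)); last first.
    exists set0; split => //; first by move=> t ht Ut; case: none; exists t.
    by rewrite measure0 mule_ge0// ?lee_fin ?(ltW C2)// hausdorff_weight_ge0.
  have [r [r0 -> hr]] := hausdorff_weightE s (diamU i) (ex_intro _ _ Ut0).
  have Cr0 : 0 <= C * r `^ s by rewrite mulr_ge0 ?powR_ge0// ltW.
  exists `[t0 - C * r `^ s, t0 + C * r `^ s]%classic; split => //.
    move=> t ht Ut; rewrite /= in_itv/= -ler_distl.
    apply: (le_trans (holder t t0 ht ht0)); rewrite ler_wpM2l ?(ltW C0)//.
    by apply: ge0_ler_powR; rewrite ?nnegrE// hr.
  rewrite lebesgue_measure_itv/=; case: ifP => _.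
    by rewrite -EFinB -EFinM lee_fin; lra.
  by rewrite -EFinM lee_fin -mulrA mulr_ge0.
rewrite -[leLHS]mule1 lee_pdivrMl//.
rewrite -nneseriesZl; last by move=> i _; exact: hausdorff_weight_ge0.
apply: (@le_trans _ _ (lebesgue_measure (`[0, 1[%classic : set R))).
  by rewrite lebesgue_measure_itv/= lte_fin ltr01 sube0.
apply: (@le_trans _ _ (\sum_(0 <= i <oo) lebesgue_measure (F i))%E).
  apply: measure_sigma_subadditive => //; first by move=> i; have [] := hF i.
  move=> t /=; rewrite in_itv/= => ht.
  have [i _ Ui] := AU _ (AG t ht).
  by exists i => //; have [_ + _] := hF i; exact.
by apply: lee_nneseries => [i _ _|i _]; [exact: measure_ge0|have [] := hF i].
Qed.

(** The cover by the N intervals of length 1 / N has total weight N^(1 - s), which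
    tends to 0. *)
Lemma hausdorff_premeasure_small A s (delta e : R) : 1 < s -> A `<=` `[0, 1] ->
  0 < delta -> 0 < e -> (hausdorff_premeasure s delta A <= e%:E)%E.
Proof.
move=> s1 A01 delta0 e0.
(* The first bound makes the mesh at most [delta], the second makes
   [N ^ (1 - s)] at most [e]. *)
pose B := Num.max delta^-1 (e `^ (- (s - 1)^-1)).
have B0 : 0 < B by rewrite lt_max invr_gt0 delta0.
pose N := (Num.truncn B).+1.
have /andP[_ BN] := truncn_itv (ltW B0); rewrite -/N in BN.
have N0 : 0 < N%:R :> R by rewrite ltr0n.
have s10 : 0 < s - 1 by lra.
have Ndelta : N%:R^-1 <= delta.
  rewrite -[leRHS]invrK lef_pV2 ?posrE ?invr_gt0// (le_trans _ (ltW BN))//.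
  by rewrite le_max lexx.
have Ne : N%:R * (N%:R^-1 `^ s) <= e.
  have -> : N%:R * (N%:R^-1 `^ s) = (N%:R `^ (s - 1))^-1 :> R.
    rewrite -powR_inv1 ?ler0n// -powRrM mulN1r -powRN opprB.
    by rewrite powRD ?powRr1 ?ler0n//; apply/implyP => _; rewrite gt_eqF.
  rewrite -[leRHS]invrK lef_pV2 ?posrE ?invr_gt0 ?powR_gt0//.
  have -> : e^-1 = (e `^ (- (s - 1)^-1)) `^ (s - 1).
    by rewrite -powRrM mulNr mulVf ?gt_eqF// powR_inv1 ?ltW.
  apply: ge0_ler_powR; rewrite ?nnegrE ?powR_ge0 ?ler0n//; first exact: ltW.
  by rewrite (le_trans _ (ltW BN))// le_max lexx orbT.
pose U i := if (i < N)%N then `[i%:R / N%:R, i.+1%:R / N%:R]%classic else set0 : set R.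
have diamU i : (diameter (U i) <= N%:R^-1%:E)%E.
  apply: ge_ereal_sup => _ [x Ux [y Uy <-]]; move: Ux Uy; rewrite /U.
  case: ifP => //= _; rewrite !in_itv/= lee_fin -natr1 mulrDl mul1r.
  by move=> /andP[? ?] /andP[? ?]; rewrite ler_norml; apply/andP; split; lra.
apply: ge_ereal_inf; exists (\sum_(0 <= i <oo) hausdorff_weight s (U i))%E.
  exists U => //; split; last by move=> i; apply: (le_trans (diamU i)); rewrite lee_fin.
  move=> x /A01 /=; rewrite in_itv/= => /andP[x0 x1].
  have [->|xn1] := eqVneq x 1.
    exists N.-1 => //; rewrite /U ltnSn /= in_itv/= divff ?gt_eqF// lexx andbT.
    by rewrite ler_pdivrMr// mul1r ler_nat.
  have Nx0 : 0 <= N%:R * x by rewrite mulr_ge0// ltW.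
  have /andP[h1 h2] := truncn_itv Nx0.
  exists (Num.truncn (N%:R * x)) => //; rewrite /U ifT.
    by rewrite /= in_itv/= ler_pdivrMr// ler_pdivlMr// [x * _]mulrC h1 ltW.
  by rewrite truncn_lt_nat// gtr_pMr// lt_neqAle xn1.
rewrite (nneseries_split 0 N) => [|i _]; last exact: hausdorff_weight_ge0.
rewrite add0n [X in (_ + X)%E]eseries0 ?adde0 => [|i Ni _]; last first.
  by rewrite /U ltnNge Ni /= /hausdorff_weight eqxx.
apply: (@le_trans _ _ (\sum_(0 <= i < N) (N%:R^-1 `^ s)%:E)%E).
  rewrite big_nat [leRHS]big_nat; apply: lee_sum => i /andP[_ iN].
  have U0 : U i !=set0.
    exists (i%:R / N%:R); rewrite /U iN /= in_itv/= lexx /=.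
    by rewrite ler_pM2r ?invr_gt0// ler_nat.
  have d1 : (diameter (U i) <= 1)%E.
    by apply: (le_trans (diamU i)); rewrite lee_fin invf_le1// ler1n.
  have [x Ux] := U0.
  rewrite /hausdorff_weight ifF; last by apply/eqP => e'; rewrite e' in Ux.
  rewrite -poweR_EFin; apply: gt0_ler_poweR; rewrite ?in_itv/= ?leey ?andbT//.
  - lra.
  - by have := diameter_ge Ux Ux; rewrite subrr normr0.
by rewrite sumEFin lee_fin sumr_const_nat subn0 -(mulr_natl (_ `^ _)).
Qed.

Lemma hausdorff_measure_eq0 A s : 1 < s -> A `<=` `[0, 1] ->
  hausdorff_measure s A = 0%E.
Proof.
move=> s1 A01; apply/eqP; rewrite eq_le; apply/andP; split.
  apply: ge_ereal_sup => _ [delta delta0 <-].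
  by apply/lee_addgt0Pr => e e0; rewrite add0e hausdorff_premeasure_small.
apply: le_ereal_sup_tmp; exists (hausdorff_premeasure s 1 A); first by exists 1 => /=.
apply: le_ereal_inf_tmp => _ [U _ <-].
by apply: nneseries_ge0 => i _ _; exact: hausdorff_weight_ge0.
Qed.

Lemma hausdorff_dim_eq1 A : A `<=` `[0, 1] ->
  (forall s, 0 <= s < 1 -> hausdorff_measure s A != 0%E) ->
  hausdorff_dim A = 1%E.
Proof.
move=> A01 pos; apply/eqP; rewrite eq_le; apply/andP; split.
  apply/lee_addgt0Pr => e e0; apply: ereal_inf_lbound; exists (1 + e) => //=.
  by split; [lra|apply: hausdorff_measure_eq0 => //; lra].
apply: le_ereal_inf_tmp => _ [s [s0 hs] <-]; rewrite lee_fin leNgt.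
by apply/negP => s1; move: (pos s); rewrite s0 s1 hs eqxx => /(_ isT).
Qed.

End HausdorffDimension.

(** * Growth of the normalization *)

Section LilNormalization.
Context {R : realType}.
Implicit Types (n : nat) (e A : R).

Definition lil_norm n : R := Num.sqrt (2 * n%:R * ln (ln n%:R)).

Lemma near_succ (P : nat -> Prop) :
  (\forall n \near \oo, P n) -> \forall n \near \oo, P n.+1.
Proof. by move=> [N _ hN]; exists N => // n /= Nn; apply: hN; exact: leqW. Qed.

Lemma near_ln_ge A : \forall n \near \oo, A <= ln (n%:R : R).
Proof.
near=> n; have hn : expR A <= n%:R by near: n; exact: nbhs_infty_ger.
by rewrite -(expRK A) ler_ln ?posrE ?expR_gt0// (lt_le_trans _ hn) ?expR_gt0.
Unshelve. all: by end_near. Qed.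

Lemma near_lnln_ge A : \forall n \near \oo, A <= ln (ln (n%:R : R)).
Proof.
near=> n; have hn : expR A <= ln n%:R by near: n; exact: near_ln_ge.
by rewrite -(expRK A) ler_ln ?posrE ?expR_gt0// (lt_le_trans _ hn) ?expR_gt0.
Unshelve. all: by end_near. Qed.

Lemma lil_norm_sq n : 0 <= ln (ln (n%:R : R)) ->
  lil_norm n ^+ 2 = 2 * n%:R * ln (ln n%:R).
Proof. by move=> h; rewrite sqr_sqrtr// !mulr_ge0// ler0n. Qed.

Lemma lil_norm_ge0 n : 0 <= lil_norm n.
Proof. exact: sqrtr_ge0. Qed.

Lemma near_lil_norm_ge A : \forall n \near \oo, A <= lil_norm n.
Proof.
near=> n.
have hn : A ^+ 2 <= n%:R by near: n; exact: nbhs_infty_ger.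
have hl : 1 <= ln (ln (n%:R : R)) by near: n; exact: near_lnln_ge.
apply: (le_trans (ler_norm A)); rewrite -sqrtr_sqr ler_wsqrtr//.
apply: (le_trans hn); rewrite [2 * _]mulrC -mulrA ler_peMr//; lra.
Unshelve. all: by end_near. Qed.

(** Since log log n <= log n and n >= (log n)^2 / 2, the quotient of h(n)^2 by n^2
    is at most 4 / log n. *)
Lemma near_lil_norm_le e : 0 < e -> \forall n \near \oo, lil_norm n <= e * n%:R.
Proof.
move=> e0; near=> n.
have n1 : 1 <= n%:R :> R by near: n; exact: nbhs_infty_ger.
have l1 : 1 <= ln (n%:R : R) by near: n; exact: near_ln_ge.
have le : 4 / e ^+ 2 <= ln (n%:R : R) by near: n; exact: near_ln_ge.
have ll1 : 1 <= ln (ln (n%:R : R)) by near: n; exact: near_lnln_ge.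
have e2 : 0 < e ^+ 2 by rewrite exprn_gt0.
have ltl : ln (ln (n%:R : R)) <= ln n%:R by rewrite ltW// ln_sublinear; lra.
have sq : ln n%:R ^+ 2 / 2 <= n%:R :> R.
  have := @expR_ge1Dxn R (ln n%:R) 1 (le_trans ler01 l1).
  have -> : (2`!)%:R = 2 :> R by [].
  by rewrite lnK ?posrE => [h|]; lra.
rewrite -[leRHS]ger0_norm ?mulr_ge0 ?(ltW e0)//.
rewrite -sqrtr_sqr ler_wsqrtr// exprMn.
have -> : e ^+ 2 * n%:R ^+ 2 = n%:R * (e ^+ 2 * n%:R) by ring.
rewrite [2 * _]mulrC -mulrA ler_wpM2l//.
rewrite ler_pdivrMr// in le.
have h1 := ler_wpM2r (le_trans ler01 l1) le.
have h2 := ler_wpM2l (ltW e2) sq.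
lra.
Unshelve. all: by end_near. Qed.

(** The squares satisfy h(n+1)^2 - h(n)^2 <= 4 log log (n+1) eventually, which is
    negligible with respect to h(n+1). *)
Lemma near_lil_norm_increment e : 0 < e ->
  \forall n \near \oo, `|lil_norm n.+1 - lil_norm n| <= e.
Proof.
move=> e0; have e20 : 0 < e / 2 by rewrite divr_gt0.
near=> n.
have n1 : 1 <= n%:R :> R by near: n; exact: nbhs_infty_ger.
have l1 : 1 <= ln (n%:R : R) by near: n; exact: near_ln_ge.
have L1 : 1 <= ln (ln (n%:R : R)) by near: n; exact: near_lnln_ge.
have hH : lil_norm n.+1 <= e / 2 * n.+1%:R.
  by near: n; exact: near_succ (near_lil_norm_le e20).
have n0 : 0 < n%:R :> R by lra.
have nS : n.+1%:R = n%:R * (1 + n%:R^-1) :> R.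
  by rewrite mulrDr mulr1 divff ?gt_eqF// natr1.
have iN : 0 < n%:R^-1 :> R by rewrite invr_gt0.
have lS : ln (n.+1%:R : R) <= ln n%:R + n%:R^-1.
  rewrite nS lnM ?posrE; try lra.
  by rewrite lerD2l le_ln1Dx//; lra.
have lm : ln (n%:R : R) <= ln n.+1%:R by rewrite ler_ln ?posrE// ler_nat.
have LS : ln (ln (n.+1%:R : R)) <= ln (ln n%:R) + n%:R^-1.
  apply: (@le_trans _ _ (ln (ln n%:R * (1 + n%:R^-1)))); last first.
    rewrite lnM ?posrE; try lra.
    by rewrite lerD2l le_ln1Dx//; lra.
  rewrite ler_ln ?posrE ?mulr_gt0//; try lra.
  by rewrite mulrDr mulr1; nra.
have Lm : ln (ln (n%:R : R)) <= ln (ln n.+1%:R) by rewrite ler_ln ?posrE//; lra.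
have G2 := lil_norm_sq (le_trans ler01 L1).
have H2 := lil_norm_sq (le_trans ler01 (le_trans L1 Lm)).
have HG : lil_norm n <= lil_norm n.+1.
  by rewrite /lil_norm ler_wsqrtr// -natr1; nra.
have nL : n%:R * ln (ln (n.+1%:R : R)) <= n%:R * ln (ln n%:R) + 1.
  have -> : n%:R * ln (ln n%:R) + 1 = n%:R * (ln (ln n%:R) + n%:R^-1) :> R.
    by rewrite mulrDr divff ?gt_eqF.
  by rewrite ler_wpM2l// ltW.
have H0 : 0 < lil_norm n.+1.
  rewrite /lil_norm sqrtr_gt0 !mulr_gt0//; lra.
rewrite ger0_norm ?subr_ge0// -(ler_pM2r H0).
have G0 := lil_norm_ge0 n.
(* With H = h(n+1) and G = h(n): (H - G) H <= H^2 - G^2 <= 4 ln ln (n+1), and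
   ln ln (n+1) = H^2 / (2 (n+1)) <= e H / 4 by the bound [hH] on H. *)
have step : 4 * ln (ln n.+1%:R) <= e * lil_norm n.+1.
  have p : 0 < n.+1%:R :> R by [].
  rewrite -(ler_pM2r p).
  have -> : 4 * ln (ln n.+1%:R) * n.+1%:R = 2 * lil_norm n.+1 ^+ 2.
    by rewrite H2; ring.
  by rewrite expr2; nra.
apply: le_trans step.
move: G2 H2; rewrite -[in X in _ -> X -> _]natr1 !expr2 => G2 H2; nra.
Unshelve. all: by end_near. Qed.

End LilNormalization.

(** * The limit sets *)

Section LilSets.
Context {R : realType}.
Implicit Types (b : nat -> nat) (n : nat).

Lemma ln2_ge : 2^-1 <= ln (2 : R).
Proof.
have -> : (2 : R) = (1 + - 2^-1)^-1 by field.
rewrite lnV ?posrE; last lra.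
have := @le_ln1Dx R (- 2^-1); lra.
Qed.

Lemma ln2_lt : ln (2 : R) < 1.
Proof.
rewrite -[ltRHS](@expRK R) ltr_ln ?posrE ?expR_gt0//.
by have := @expR_gt1Dx R 1; rewrite oner_eq0 => /(_ isT); lra.
Qed.

Lemma near_lil_norm_gt0 : \forall n \near \oo, 0 < lil_norm n :> R.
Proof.
near=> n; apply: (@lt_le_trans _ _ 1) => //; near: n; exact: near_lil_norm_ge.
Unshelve. all: by end_near. Qed.

Lemma cvg_div_lil_norm (c : R) : (c / lil_norm n)%:E @[n --> \oo] --> 0%:E.
Proof.
apply: cvg_EFin; first by near=> n.
rewrite -(mulr0 c); apply: cvgMl_tmp; apply/gtr0_cvgV0; first exact: near_lil_norm_gt0.
by apply/cvgryPge => A; exact: near_lil_norm_ge.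
Unshelve. all: by end_near. Qed.

(** The digit of index n lies between 2^(b n) and 2^(b n + 1), which determines its
    logarithm up to log 2.  The exponents b are indexed like the digits, from 1. *)
Lemma pierce_lil_set_code b (beta : \bar R) (t : R) :
  (0 < b 1)%N -> (forall n, b n.+1 < b n.+2)%N -> 0 <= t < 1 ->
  (((b n)%:R * ln 2 - n%:R) / lil_norm n)%:E @[n --> \oo] --> beta ->
  pierce_lil_set beta (pierce_value (pierce_code (fun i => b i.+1) t)).
Proof.
move=> b1 bS /andP[t0 _] lim.
have hd := digit_sequence_code (a := fun i => b i.+1) b1 bS t0.
split; [exact: pierce_value_itv|exact: irrational_pierce_value|].
have lim2 : (((b n)%:R * ln 2 - n%:R) / lil_norm n : R)%:E +
    (ln 2 / lil_norm n)%:E @[n --> \oo] --> beta.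
  rewrite -[X in _ --> X]adde0; apply: cvgeD => //; last exact: cvg_div_lil_norm.
  by rewrite fin_num_adde_defl.
have bound m : (0 < m)%N -> 0 < lil_norm m :> R ->
    ((((b m)%:R * ln 2 - m%:R) / lil_norm m : R)%:E <=
    (pierce_lil_ratio (pierce_value (pierce_code (fun i => b i.+1) t) : R) m)%:E <=
    (((b m)%:R * ln 2 - m%:R) / lil_norm m : R)%:E + (ln 2 / lil_norm m)%:E)%E.
  case: m => // m _ h0.
  rewrite /pierce_lil_ratio pierce_digit_value// -/(lil_norm m.+1) -EFinD !lee_fin.
  rewrite -mulrDl !ler_pM2r ?invr_gt0//.
  have /andP[l u] := pierce_code_itv (fun i => b i.+1) m t0.
  rewrite -pmulrn; set d := pierce_code _ _ _ in l u *.
  have d0 : 0 < d%:R :> R by rewrite ltr0n (leq_trans _ l)// expn_gt0.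
  have lnpow k : k%:R * ln 2 = ln ((2 ^ k)%N%:R : R) by rewrite natrX lnXn// mulr_natl.
  have h1 : (b m.+1)%:R * ln 2 <= ln (d%:R : R).
    by rewrite lnpow ler_ln ?posrE ?ler_nat// ltr0n expn_gt0.
  have h2 : ln (d%:R : R) <= (b m.+1).+1%:R * ln 2.
    by rewrite lnpow ler_ln ?posrE ?ler_nat ?(ltnW u)// ltr0n expn_gt0.
  rewrite -natr1 mulrDl mul1r in h2.
  by apply/andP; split; lra.
apply: squeeze_cvge lim lim2; near=> n.
apply: bound; near: n; [exact: nbhs_infty_gt|exact: near_lil_norm_gt0].
Unshelve. all: by end_near. Qed.

Lemma hausdorff_dim_pierce_lil_set b (K : nat) (beta : \bar R) :
  (0 < b 1)%N -> (forall n, b n.+1 < b n.+2)%N -> (forall n, b n.+1 <= K * n.+1)%N ->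
  (((b n)%:R * ln 2 - n%:R) / lil_norm n)%:E @[n --> \oo] --> beta ->
  hausdorff_dim (pierce_lil_set beta) = 1%E.
Proof.
move=> b1 bS bK lim; apply: hausdorff_dim_eq1 => [x [/= + _ _]|s hs].
  by rewrite !in_itv/= => /andP[/ltW -> ->].
have [C C0 holder] := pierce_code_holder (a := fun i => b i.+1) b1 bS bK hs.
have /andP[s0 _] := hs.
apply: (hausdorff_measure_neq0 s0 C0 _ holder) => t ht.
exact: pierce_lil_set_code.
Qed.

Lemma near_div_lil_norm_ge (A : R) : \forall n \near \oo, A <= n%:R / lil_norm n :> R.
Proof.
have A0 : 0 < `|A| + 1 :> R by rewrite ltr_wpDl.
near=> n.
have h0 : 0 < lil_norm n :> R by near: n; exact: near_lil_norm_gt0.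
have hn : lil_norm n <= (`|A| + 1)^-1 * n%:R :> R.
  by near: n; apply: near_lil_norm_le; rewrite invr_gt0.
rewrite ler_pdivlMr//; rewrite ler_pdivlMl// in hn.
apply: le_trans hn; rewrite ler_pM2r//.
by rewrite (le_trans (ler_norm A))// lerDl.
Unshelve. all: by end_near. Qed.

Lemma hausdorff_dim_pierce_lil_set_pinfty :
  hausdorff_dim (pierce_lil_set (+oo : \bar R)) = 1%E.
Proof.
apply: (@hausdorff_dim_pierce_lil_set (muln 3) 3) => //; first by move=> n; lia.
have c0 : 0 < 3 * ln (2 : R) - 1 by have := ln2_ge; lra.
apply/cvgeyPge => A; near=> n.
have h : A / (3 * ln 2 - 1) <= n%:R / lil_norm n :> R.
  by near: n; exact: near_div_lil_norm_ge.
rewrite lee_fin natrM; rewrite ler_pdivrMr// in h; apply: (le_trans h).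
by rewrite le_eqVlt; apply/orP; left; apply/eqP; ring.
Unshelve. all: by end_near. Qed.

Lemma hausdorff_dim_pierce_lil_set_ninfty :
  hausdorff_dim (pierce_lil_set (-oo : \bar R)%E) = 1%E.
Proof.
apply: (@hausdorff_dim_pierce_lil_set id 1) => //; first by move=> n; rewrite mul1n.
have c0 : 0 < 1 - ln (2 : R) by have := ln2_lt; lra.
apply/cvgeNyPle => A; near=> n.
have h : - A / (1 - ln 2) <= n%:R / lil_norm n :> R.
  by near: n; exact: near_div_lil_norm_ge.
rewrite lee_fin; rewrite ler_pdivrMr// lerNl in h; apply: le_trans h.
by rewrite le_eqVlt; apply/orP; left; apply/eqP; ring.
Unshelve. all: by end_near. Qed.

(** Beyond some N the exponents are the integer parts of g(n) = (n + beta h(n)) /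
    log 2: the increment g(n+1) - g(n) tends to 1 / log 2 > 1, so they increase
    strictly, and n <= g(n) <= 4 n.  Below N, where g may misbehave, the exponent
    n is used; it stays below the later ones because g(N) >= N. *)
Lemma hausdorff_dim_pierce_lil_set_fin (beta : R) :
  hausdorff_dim (pierce_lil_set beta%:E) = 1%E.
Proof.
pose g n : R := (n%:R + beta * lil_norm n) / ln 2.
have l2 := ln2_ge; have l1 := ln2_lt.
have l0 : 0 < ln (2 : R) by lra.
have c0 : 0 < 1 - ln (2 : R) by lra.
(* [e] is chosen so that [beta] times an error of size [e] is at most the
   margin [1 - ln 2]; the added [1] covers [beta = 0]. *)
pose e := (1 - ln 2) / (`|beta| + 1) : R.
have beta1 : 0 < `|beta| + 1 by rewrite ltr_wpDl.
have e0 : 0 < e by rewrite divr_gt0.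
have betae (x y : R) : 0 <= y -> `|x| <= e * y -> `|beta * x| <= (1 - ln 2) * y.
  move=> y0 xe; rewrite normrM.
  apply: le_trans (ler_wpM2l (normr_ge0 beta) xe) _.
  by rewrite /e mulrA ler_wpM2r// mulrCA ger_pMr// ler_pdivrMr// mul1r lerDl.
have [N _ hN] : \forall n \near \oo, [/\ lil_norm n <= e * n%:R &
    `|lil_norm n.+1 - lil_norm n| <= e].
  near=> n; split; near: n; first exact: near_lil_norm_le.
  exact: near_lil_norm_increment.
have g_ge n : (N <= n)%N -> n%:R <= g n.
  move=> /hN[+ _]; rewrite -[X in X <= _]ger0_norm ?lil_norm_ge0// => /betae.
  rewrite ler0n ler_norml => /(_ isT)/andP[h _].
  by rewrite /g ler_pdivlMr//; lra.
have g_le n : (N <= n)%N -> g n <= (4 * n)%:R.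
  move=> /hN[+ _]; rewrite -[X in X <= _]ger0_norm ?lil_norm_ge0// => /betae.
  rewrite ler0n ler_norml => /(_ isT)/andP[_ h].
  rewrite /g ler_pdivrMr// natrM.
  have := ler0n R n; nra.
have gS n : (N <= n)%N -> g n + 1 <= g n.+1.
  move=> /hN[_]; rewrite -[X in _ <= X]mulr1 => /betae.
  rewrite ler01 mulr1 ler_norml => /(_ isT)/andP[h _].
  rewrite /g -[X in _ + X](@divff _ (ln 2)) ?gt_eqF// -mulrDl ler_pM2r ?invr_gt0//.
  by rewrite -natr1; lra.
pose b n := if (n < N)%N then n else Num.truncn (g n).
have g0 n : (N <= n)%N -> 0 <= g n by move=> /g_ge; apply: le_trans.
have b_small n : (n < N)%N -> b n = n by rewrite /b => ->.
have b_large n : (N <= n)%N -> b n = Num.truncn (g n) by rewrite /b ltnNge => ->.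
have b_ge n : (n <= b n)%N.
  case: (ltnP n N) => [/b_small -> //|Nn].
  by rewrite b_large// truncn_ge_nat ?g_ge ?g0.
have bS n : (b n < b n.+1)%N.
  case: (ltnP n N) => [/b_small -> |Nn]; first exact: b_ge.
  rewrite !b_large ?leqW// truncn_ge_nat ?g0 ?leqW// -natr1.
  by apply: le_trans (gS _ Nn); rewrite lerD2r truncn_le g0.
have b_le n : (b n <= 4 * n)%N.
  case: (ltnP n N) => [/b_small -> |Nn]; first by rewrite leq_pmull.
  by rewrite b_large// -(ler_nat R) (le_trans _ (g_le _ Nn))// truncn_le g0.
apply: (@hausdorff_dim_pierce_lil_set b 4 _ (b_ge 1%N) (fun n => bS n.+1)
  (fun n => b_le n.+1)).
have lim1 : (beta%:E - (ln 2 / lil_norm n)%:E)%E @[n --> \oo] --> beta%:E.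
  rewrite -[X in _ --> X]sube0; apply: cvgeB => //; first exact: cvg_cst.
  exact: cvg_div_lil_norm.
apply: squeeze_cvge lim1 (cvg_cst _); near=> n.
have Nn : (N <= n)%N by near: n; exact: nbhs_infty_ge.
have h0 : 0 < lil_norm n :> R by near: n; exact: near_lil_norm_gt0.
rewrite (b_large _ Nn).
have /andP[] := truncn_itv (g0 _ Nn); move: (Num.truncn _) => m.
rewrite /g ler_pdivlMr// ltr_pdivrMr// -[m.+1%:R]natr1 mulrDl mul1r => h1 h2.
rewrite -EFinB !lee_fin ler_pdivlMr// ler_pdivrMr// mulrBl divfK ?gt_eqF//.
by apply/andP; split; lra.
Unshelve. all: by end_near. Qed.

End LilSets.

Local Open Scope ereal_scope.

Theorem corollary1p16 (R : realType) (beta : \bar R) :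
  hausdorff_dim (pierce_lil_set beta) = 1.
Proof.
case: beta => [beta| |].
- exact: hausdorff_dim_pierce_lil_set_fin.
- exact: hausdorff_dim_pierce_lil_set_pinfty.
- exact: hausdorff_dim_pierce_lil_set_ninfty.
Qed.
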